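(* There exist an $\alpha$-favorable topological space $X$, a countably compact subspace $Y\subseteq\beta\mathbb N\setminus\mathbb N$ which is dense in $\beta\mathbb N\setminus\mathbb N$, and a separately continuous function $f:X\times Y\to\mathbb R$ which is (jointly) discontinuous at every point of $X\times Y$.
   Context: All topological spaces are assumed nonempty. $\beta\mathbb N$ is the Stone–Čech compactification of the countable discrete space $\mathbb N$, and $\beta\mathbb N\setminus\mathbb N$ carries the subspace topology. A function $f:X\times Y\to\mathbb R$ is separately continuous if for every $x\in X$ the function $y\mapsto f(x,y)$ is continuous and for every $y\in Y$ the function $x\mapsto f(x,y)$ is continuous. Choquet game on $X$: two players $\alpha$ and $\beta$ alternate. Player $\beta$ first chooses a nonempty open set $U_0\subseteq X$, then $\alpha$ chooses a nonempty open set $V_1\subseteq U_0$, then $\beta$ chooses a nonempty open set $U_1\subseteq V_1$, then $\alpha$ chooses a nonempty open set $V_2\subseteq U_1$, and so on. Player $\alpha$ wins if $\bigcap_{n=1}^\infty V_n\neq\emptyset$; otherwise $\beta$ wins. The space $X$ is called $\alpha$-favorable if $\alpha$ has a winning strategy in this game. *)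

(* Defs.v *)
From HB Require Import structures.
From mathcomp Require Import all_boot all_order all_algebra.
From mathcomp Require Import all_classical all_reals all_analysis.
Import numFieldNormedType.Exports.

Set Implicit Arguments.
Unset Strict Implicit.
Unset Printing Implicit Defensive.

Local Open Scope classical_set_scope.

(* The Stone-Cech compactification of the discrete space nat, realised as the
   space of ultrafilters on nat; the sets [set u | u contains A], A : set nat,
   form a base of its topology.  The lemmas betaN_* below state that this is
   the Stone-Cech compactification: a compact Hausdorff space containing nat
   as a dense discrete subspace, with the extension property. *)
Record betaN : Type := BetaN {
  betaN_filter : set_system nat ;
  #[global] betaN_ultra :: UltraFilter betaN_filter
}.

HB.instance Definition _ := gen_eqMixin betaN.
HB.instance Definition _ := gen_choiceMixin betaN.

Definition betaN_base (A : set nat) : set betaN := [set u | betaN_filter u A].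

Lemma betaN_base_cover : \bigcup_(A in [set: set nat]) betaN_base A = setT.
Proof.
rewrite -subTset => u _; exists setT => //.
by exact: filterT.
Qed.

Lemma betaN_base_join (A B : set nat) (u : betaN) :
  [set: set nat] A -> [set: set nat] B -> betaN_base A u -> betaN_base B u ->
  exists C, [/\ [set: set nat] C, betaN_base C u &
    betaN_base C `<=` betaN_base A `&` betaN_base B].
Proof.
move=> _ _ uA uB; exists (A `&` B); split => //.
  by exact: filterI.
move=> v vAB.
by split; apply: filterS vAB => n [].
Qed.

HB.instance Definition _ :=
  isBaseTopological.Build betaN betaN_base_cover betaN_base_join.

Definition betaN_of_nat (n : nat) : betaN := BetaN (principal_filter_ultra n).

Lemma betaN_eq (u v : betaN) :
  betaN_filter u = betaN_filter v -> u = v.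
Proof.
by case: u v => [F uF] [G uG] /= FG; subst G; congr BetaN; exact: Prop_irrelevance.
Qed.

Lemma betaN_openE (U : set betaN) :
  open U <-> forall u, U u -> exists2 A, betaN_filter u A & betaN_base A `<=` U.
Proof.
split.
  move=> [D _ <-] u [A DA uA]; exists A => // v vA; by exists A.
move=> h; exists [set A | betaN_base A `<=` U] => //.
apply/seteqP; split => [u [A AU uA]|u /h[A uA AU]]; first exact: AU.
by exists A.
Qed.

Lemma betaN_base_open (A : set nat) : open (betaN_base A).
Proof. by apply/betaN_openE => u uA; exists A. Qed.

Lemma betaN_baseC (A : set nat) : ~` betaN_base A = betaN_base (~` A).
Proof.
apply/seteqP; split => u => /=.
  by case: (in_ultra_setVsetC A (betaN_ultra u)).
move=> uC uA; have : betaN_filter u (A `&` ~` A) by exact: filterI.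
by rewrite setICr => /filter_not_empty.
Qed.

Lemma betaN_of_nat_inj : injective betaN_of_nat.
Proof.
move=> m n /(congr1 betaN_filter) /= e.
have : principal_filter n [set m] by rewrite -e; exact/principal_filterP.
by move/principal_filterP => /= ->.
Qed.

Lemma betaN_of_nat_isolated (n : nat) : open [set betaN_of_nat n].
Proof.
suff -> : [set betaN_of_nat n] = betaN_base [set n] by exact: betaN_base_open.
apply/seteqP; split => u /=.
  by move=> ->; exact/principal_filterP.
move=> un; apply: betaN_eq; apply/esym.
apply: max_filter => A uA; apply/principal_filterP.
have : betaN_filter u (A `&` [set n]) by exact: filterI.
by move/filter_ex => [m [Am /= <-]].
Qed.

Lemma betaN_of_nat_dense : dense (range betaN_of_nat).
Proof.
move=> U [u Uu] /betaN_openE/(_ u Uu)[A uA AU].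
have [n An] := filter_ex uA; exists (betaN_of_nat n); split; last by exists n.
by apply: AU; apply/principal_filterP.
Qed.

Lemma betaN_hausdorff : hausdorff_space betaN.
Proof.
move=> u v uv; apply: betaN_eq.
apply/esym; apply: max_filter.
move=> A uA; have [//|vC] := in_ultra_setVsetC A (betaN_ultra v).
have : betaN_base A `&` betaN_base (~` A) !=set0.
  by apply: uv; apply: open_nbhs_nbhs; split => //; exact: betaN_base_open.
by move=> [w [/[swap]]]; rewrite -betaN_baseC.
Qed.

Lemma betaN_compact : compact [set: betaN].
Proof.
rewrite compact_ultra => F uF _.
pose G : set_system nat := [set A | F (betaN_base A)].
have pG : ProperFilter G.
  apply: Build_ProperFilter_ex.
    move=> A GA; have [u uA] : betaN_base A !=set0 by exact: (@filter_ex _ F).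
    exact: (@filter_ex _ (betaN_filter u)).
  split.
  - have e : betaN_base setT = setT.
      by apply/seteqP; split => // u _; exact: (@filterT _ (betaN_filter u)).
    by rewrite /G /= e; exact: (@filterT _ F).
  - move=> A B GA GB; suff : F (betaN_base (A `&` B)) by [].
    apply: filterS (@filterI _ F _ _ _ GA GB) => u [uA uB].
    exact: (@filterI _ (betaN_filter u)).
  - move=> A B AB; suff : F (betaN_base A) -> F (betaN_base B) by [].
    by apply: filterS => u; exact: (@filterS _ (betaN_filter u)).
have uG : UltraFilter G.
  split => // H pH GH; apply/seteqP; split => // A HA.
  have [//|] := in_ultra_setVsetC (betaN_base A) uF.
  rewrite betaN_baseC => /GH HC.
  have : H (A `&` ~` A) by exact: filterI.
  by rewrite setICr => /filter_not_empty.
exists (BetaN uG); split => // U; rewrite nbhsE => -[V [oV Vu] VU].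
move/betaN_openE: oV => /(_ _ Vu)[A /= FA AV].
have : F U by apply: (@filterS _ F _ _ _ _ FA); exact: subset_trans VU.
by [].
Qed.

Lemma betaN_extension (K : topologicalType) (g : nat -> K) :
  hausdorff_space K -> compact [set: K] ->
  exists2 h : betaN -> K, continuous h & h \o betaN_of_nat = g.
Proof.
move=> hK cK.
have cvgg (u : betaN) : exists p : K, g @ betaN_filter u --> p.
  have [p [_ gp]] : [set: K] `&` cluster (g @ betaN_filter u) !=set0.
    by apply: cK; exact: filterT.
  exists p => W pW; change (betaN_filter u (g @^-1` W)).
  have [//|uC] := in_ultra_setVsetC (g @^-1` W) (betaN_ultra u).
  by have [x [/[swap]]] := gp (~` W) W uC pW.
have [h hP] := choice cvgg; exists h => [u W uW|].
  have [V hV clV] := compact_regular hK cK (@filterT _ _ (nbhs_filter (h u))) uW.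
  rewrite nbhsE; exists (betaN_base (g @^-1` V)).
    by split; [exact: betaN_base_open|exact: (hP u)].
  move=> v vV; apply: clV => B vB.
  have : betaN_filter v (g @^-1` V `&` g @^-1` B).
    by apply: filterI => //; exact: (hP v).
  by move=> /filter_ex[n [Vn Bn]]; exists (g n).
apply/funext => n; apply: hK => A B hA gB.
have /principal_filterP nA := hP (betaN_of_nat n) A hA.
by exists (g n); split => //; exact: nbhs_singleton.
Qed.

Definition betaN_remainder : set betaN := ~` range betaN_of_nat.

Definition countably_compact (T : topologicalType) (A : set T) :=
  forall U : nat -> set T, (forall n, open (U n)) ->
  A `<=` cover [set: nat] U -> finite_subset_cover [set: nat] U A.

Definition separately_continuous (X Y Z : topologicalType) (f : X * Y -> Z) :=
  (forall x, continuous (fun y => f (x, y))) /\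
  (forall y, continuous (fun x => f (x, y))).

Section choquet_game.
Variable X : topologicalType.
Implicit Types U V : nat -> set X.

Definition nonempty_open (W : set X) := open W /\ W !=set0.

(* A run of the game consists of the moves U 0, U 1, ... of player beta and
   the moves V 1, V 2, ... of player alpha; V 0 plays no role. *)
Definition beta_legal U V (n : nat) :=
  nonempty_open (U n) /\ ((0 < n)%N -> U n `<=` V n).

Definition alpha_legal U V (n : nat) :=
  nonempty_open (V n.+1) /\ V n.+1 `<=` U n.

(* A strategy for alpha maps the moves [:: U 0; ...; U n] of beta to the answer
   V n.+1; alpha's own previous moves are determined by those of beta. *)
Definition alpha_answers (s : seq (set X) -> set X) U : nat -> set X :=
  fun n => s (mkseq U n).

(* The first clause is about finite partial runs: alpha has to make a legal
   move as long as beta has done so. *)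
Definition alpha_winning (s : seq (set X) -> set X) :=
  forall U, let V := alpha_answers s U in
  (forall n, (forall k, (k <= n)%N -> beta_legal U V k) -> alpha_legal U V n) /\
  ((forall n, beta_legal U V n) -> \bigcap_(n in [set n | (0 < n)%N]) V n !=set0).

Definition alpha_favorable := exists s, alpha_winning s.

End choquet_game.
Arguments alpha_favorable : clear implicits.

(* Main.v *)
Require Import Defs.
From HB Require Import structures.
From mathcomp Require Import all_boot all_order all_algebra.
From mathcomp Require Import all_classical all_reals all_analysis.
From mathcomp Require Import finmap zify.
Import Order.TTheory GRing.Theory Num.Theory.
Import numFieldNormedType.Exports.

Set Implicit Arguments.
Unset Strict Implicit.
Unset Printing Implicit Defensive.

Local Open Scope classical_set_scope.

(** The example consists of sets and ultrafilters, related by membership.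

    Call a family [I] of subsets of [nat] a tall P-ideal when it is closed
    under almost subsets, every sequence in [I] has a pseudo-union in [I], and
    every infinite set contains an infinite member of [I].  In the remainder of
    the Stone-Cech compactification, the ultrafilters disjoint from [I] form a
    closed P-set (by pseudo-unions) which is nowhere dense (by tallness).

    - [X] is the group of subsets of [nat] under symmetric difference, with the
      tall P-ideals as a neighbourhood base at the empty set.
    - [Y] is the set of the ultrafilters disjoint from some tall P-ideal.
    - [f (A, y)] is 1 if [A] belongs to [y], and 0 otherwise.

    In the variable [y], [f] is the indicator of a clopen set.  In the variable
    [A] it is locally constant: if [y] is disjoint from [I] and [A `+` B] is in
    [I], then [A] and [B] are equal modulo [y].  It is nowhere continuous: a
    basic neighbourhood of [(A, y)] is given by a tall P-ideal [I] and a set [C]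
    in [y]; tallness gives an infinite [D] in [I] inside [C], and some [z] in
    [Y] contains [D].  Both [A `|` D] and [A `\` D] lie in the coset of [A]
    modulo [I], and [f] takes the values 1 and 0 on them at [z].

    Three properties of tall P-ideals make the rest work.  A decreasing sequence
    of cosets of tall P-ideals has a common point ([ideal_coset_fusion]), so
    alpha wins by always playing a coset.  Tall P-ideals are closed under
    countable intersections ([tall_pideal_bigcap]); hence the closure in the
    remainder of a countable subset of [Y] stays inside [Y], and [Y] is
    countably compact.  Finally, every infinite [C] is outside some tall
    P-ideal, namely the sets of density zero relative to [C]
    ([density_zero_tall_pideal], [density_zeroN]), so [C] belongs to some [y] in [Y], and [Y] is
    dense. *)

(** * Tall P-ideals *)

Notation almost_subset A B := (\forall n \near \oo, A n -> B n).

Definition unbounded (C : set nat) := forall m, exists2 n, (m <= n)%N & C n.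

(** Closure under finite unions and membership of the finite sets are not
    listed because they follow: a pseudo-union of a two-valued sequence almost
    contains the union of both values.  The improper ideal
    qualifies; its single coset is the whole space. *)
Record tall_pideal (I : set (set nat)) : Prop := TallPideal {
  pideal_almostS : forall A B, almost_subset A B -> I B -> I A;
  pideal_pseudounion : forall E : nat -> set nat, (forall n, I (E n)) ->
    exists2 F, I F & forall n, almost_subset (E n) F;
  pideal_tall : forall C, unbounded C ->
    exists D, [/\ D `<=` C, I D & unbounded D] }.

Lemma near_lt (P : nat -> nat -> Prop) (N : nat) :
  (forall k, (k < N)%N -> \forall x \near \oo, P k x) ->
  \forall x \near \oo, forall k, (k < N)%N -> P k x.
Proof.
elim: N => [|N IH] h; first by near=> x.
apply: filterS2 (h N (ltnSn N)) (IH (fun k kN => h k (ltnW kN))) => x PN Px k.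
by rewrite ltnS leq_eqVlt => /predU1P[->|/Px].
Unshelve. all: by end_near. Qed.

Lemma subset_almost (A B : set nat) : A `<=` B -> almost_subset A B.
Proof. by move=> AB; exists 0%N => // n _; exact: AB. Qed.

Section pideal.
Variables (I : set (set nat)) (hI : tall_pideal I).

Lemma pideal_sub (A B : set nat) : A `<=` B -> I B -> I A.
Proof. by move=> AB; apply: (pideal_almostS hI); exact: subset_almost. Qed.

Lemma pideal_bounded (A : set nat) m : A `<=` `I_m -> I A.
Proof.
move=> Am; have [|D [_ ID _]] := pideal_tall hI (C := setT).
  by move=> n; exists n.
apply: (pideal_almostS hI) ID; exists m => // n /= mn /Am /=.
by rewrite ltnNge mn.
Qed.

Lemma pideal_set0 : I set0.
Proof. exact: (@pideal_bounded _ 0). Qed.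

Lemma pideal_setU (A B : set nat) : I A -> I B -> I (A `|` B).
Proof.
move=> IA IB.
have [n|F IF hF] := pideal_pseudounion hI
  (E := fun n => if n is 0 then A else B).
  by case: n.
apply: (pideal_almostS hI) IF.
by apply: filterS2 (hF 0%N) (hF 1%N) => n h0 h1 [/h0|/h1].
Qed.

Lemma pideal_setY_trans (A B C : set nat) :
  I (A `+` B) -> I (B `+` C) -> I (A `+` C).
Proof.
move=> IAB IBC; apply: (pideal_sub _ (pideal_setU IAB IBC)) => x /=.
by have [] := pselect (B x); tauto.
Qed.

End pideal.

Lemma tall_pideal_setT : tall_pideal setT.
Proof.
split => // [E _|C uC]; first by exists setT => // n; exact: subset_almost.
by exists C; split.
Qed.

(** The intersection inherits pseudo-unions because countable gaps are filled:
    if every [E k] is almost contained in every [F n], then the set of the [x]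
    lying in some [E k] and in [F 0, ..., F k] almost contains each [E k] and is
    almost contained in each [F n].  Tallness is a diagonal argument: a
    decreasing sequence of infinite sets [D n] in [I n] has an infinite
    pseudo-intersection. *)
Lemma tall_pideal_bigcap (I : nat -> set (set nat)) :
  (forall n, tall_pideal (I n)) -> tall_pideal [set E | forall n, I n E].
Proof.
move=> hI; split => [A B AB IB n|E IE|C uC].
- exact: (pideal_almostS (hI n)) AB (IB n).
- have /choice[F hF] (n : nat) :
      exists F, I n F /\ forall k, almost_subset (E k) F.
    have [F IF EF] := pideal_pseudounion (hI n) (IE^~ n).
    by exists F.
  exists [set x | exists2 k, E k x & forall n, (n < k.+1)%N -> F n x] => [n|k].
    apply: (pideal_almostS (hI n) (B := F n)); last by case: (hF n).
    have := near_lt (fun k (_ : (k < n)%N) => (hF n).2 k).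
    apply: filterS => x EF [k Ekx Fx].
    have [kn|nk] := ltnP k n; first exact: EF Ekx.
    by apply: Fx; rewrite ltnS.
  have := near_lt (fun n (_ : (n < k.+1)%N) => (hF n).2 k).
  by apply: filterS => x EF Ekx; exists k => // n nk; exact: EF Ekx.
- have /choice[g hg] (p : nat * set nat) : exists D, unbounded p.2 ->
      [/\ D `<=` p.2, I p.1 D & unbounded D].
    have [up|nup] := pselect (unbounded p.2); last by exists set0.
    by have [D ?] := pideal_tall (hI p.1) up; exists D.
  pose D := fix D n := if n is m.+1 then g (n, D m) else g (0%N, C).
  have uD n : unbounded (D n).
    elim: n => [|n IH]; first by case: (hg (0%N, C)).
    by case: (hg (n.+1, D n)).
  have ID n : I n (D n).
    case: n => [|n]; first by case: (hg (0%N, C)).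
    by case: (hg (n.+1, D n) (uD n)).
  have DS n : D n.+1 `<=` D n by case: (hg (n.+1, D n) (uD n)).
  have Dle n k : D (n + k)%N `<=` D n.
    elim: k => [|k IH]; first by rewrite addn0.
    by rewrite addnS => x /DS /IH.
  have /choice[d hd] (n : nat) : exists d, (n <= d)%N /\ D n d.
    by have [d nd Dd] := uD n n; exists d.
  exists (range d); split => [_ [n _ <-]|n|m].
  + have : D 0%N (d n) by apply: (Dle 0%N n); rewrite add0n; exact: (hd n).2.
    by have [D0C _ _] := hg (0%N, C) uC => /D0C.
  + apply: (pideal_almostS (hI n)) (ID n).
    have : \forall x \near \oo, forall k, (k < n)%N -> d k <> x.
      apply: near_lt => k _; exists (d k).+1 => // x /[swap] <- /=.
      by rewrite ltnn.
    apply: filterS => x dx [k _ dkx].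
    have [/dx//|nk] := ltnP k n.
    rewrite -dkx; apply: (Dle n (k - n)%N).
    by rewrite subnKC//; exact: (hd k).2.
  + by exists (d m); [exact: (hd m).1|exists m].
Qed.

Lemma tall_pidealI (I J : set (set nat)) :
  tall_pideal I -> tall_pideal J -> tall_pideal (I `&` J).
Proof.
move=> hI hJ; pose K n := if n is 0 then I else J.
suff -> : I `&` J = [set E | forall n, K n E].
  by apply: tall_pideal_bigcap => -[].
apply/seteqP; split => [E [IE JE] [|n]//|E KE].
by split; [exact: (KE 0%N)|exact: (KE 1%N)].
Qed.

(** * Density zero relative to an infinite set *)

Definition counting_function (A : set nat) (n : nat) : nat :=
  (\sum_(k < n) `[< A k >])%N.

Section counting.
Implicit Types A B C : set nat.
Local Notation cnt := counting_function.

Lemma counting0 A : cnt A 0 = 0%N.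
Proof. by rewrite /cnt big_ord0. Qed.

Lemma countingS A n : cnt A n.+1 = (cnt A n + `[< A n >])%N.
Proof. by rewrite /cnt big_ord_recr. Qed.

Lemma counting_homo A : {homo cnt A : m n / (m <= n)%N}.
Proof.
apply: homo_leq => [//|y x z|n]; first exact: leq_trans.
by rewrite countingS leq_addr.
Qed.

Lemma counting_le A B n : (forall k, (k < n)%N -> A k -> B k) ->
  (cnt A n <= cnt B n)%N.
Proof.
move=> AB; apply: leq_sum => k _.
by case: asboolP => // /(AB _ (ltn_ord k)) /asboolP ->.
Qed.

Lemma counting_setU A B n : (cnt (A `|` B) n <= cnt A n + cnt B n)%N.
Proof.
rewrite /cnt -big_split; apply: leq_sum => k _ /=.
by case: asboolP => //= -[] /asboolP ->//; rewrite addn1.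
Qed.

Lemma counting_set1 m n : (cnt [set m] n <= (m < n))%N.
Proof.
elim: n => [|n IH]; first by rewrite counting0.
by rewrite countingS; case: asboolP => /= [|]; move: IH; lia.
Qed.

Lemma counting_image (d : nat -> nat) N n : (cnt (d @` `I_N) n <= N)%N.
Proof.
elim: N => [|N IH].
  rewrite II0 image_set0 /cnt big1// => k _.
  by case: asboolP.
have -> : d @` `I_N.+1 = d @` `I_N `|` [set d N].
  by rewrite IIS image_setU image_set1.
apply: leq_trans (counting_setU _ _ _) _; have := counting_set1 (d N) n.
by move: IH; case: (d N < n)%N; lia.
Qed.

Lemma counting_unbounded C c :
  unbounded C -> \forall n \near \oo, (c <= cnt C n)%N.
Proof.
move=> uC; elim: c => [|c [m _ IH]]; first by near=> n.
have [x mx Cx] := uC m; exists x.+1 => // n xn.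
apply: leq_trans (counting_homo C xn).
rewrite countingS; move/asboolP : Cx => ->; rewrite addn1 ltnS.
exact: IH.
Unshelve. all: by end_near. Qed.

End counting.

Definition relative_density_zero (C E : set nat) :=
  forall t, \forall n \near \oo,
    (t * counting_function (E `&` C) n <= counting_function C n)%N.

Section density.
Variables (C : set nat) (uC : unbounded C).
Local Notation cnt := counting_function.
Local Notation Z := (relative_density_zero C).

Lemma density_zero_almostS A B : almost_subset A B -> Z B -> Z A.
Proof.
move=> [m _ mAB] ZB t.
apply: filterS2 (ZB (2 * t)%N) (counting_unbounded (2 * t * m)%N uC) => n h1 h2.
have : (cnt (A `&` C) n <= m + cnt (B `&` C) n)%N.
  apply: leq_trans (leq_add (counting_image id m n) (leqnn _)).
  apply: leq_trans (counting_setU _ _ _); apply: counting_le => x _ [Ax Cx].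
  have [xm|mx] := ltnP x m; first by left; exists x.
  by right; split => //; exact: mAB.
by nia.
Qed.

Lemma density_zero_setU A B : Z A -> Z B -> Z (A `|` B).
Proof.
move=> ZA ZB t; apply: filterS2 (ZA (2 * t)%N) (ZB (2 * t)%N) => n.
by rewrite setIUl; have := counting_setU (A `&` C) (B `&` C) n; nia.
Qed.

(** Past a threshold [m k], the union [G k] of [E 0, ..., E k] has relative
    density at most [1 / k].  The pseudo-union admits the points of [E j] only
    from the stage [late j] on, so that below any [n] it is contained in [G k]
    for the largest [k] whose threshold [n] has passed. *)
Lemma density_zero_pseudounion (E : nat -> set nat) : (forall n, Z (E n)) ->
  exists2 F, Z F & forall n, almost_subset (E n) F.
Proof.
move=> ZE; pose G k := [set x | exists2 j, (j <= k)%N & E j x].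
have ZG k : Z (G k).
  elim: k => [|k IH].
    by apply: density_zero_almostS (ZE 0%N); apply: subset_almost => x [[]].
  apply: density_zero_almostS (density_zero_setU IH (ZE k.+1)).
  apply: subset_almost => x [j]; rewrite leq_eqVlt => /predU1P[->|jk] Ex.
    by right.
  by left; exists j.
have /choice[m hm] k : exists m, forall n, (m <= n)%N ->
    (k * cnt (G k `&` C) n <= cnt C n)%N.
  by have [m _ hm] := ZG k k; exists m.
pose late k n := (k <= n)%N /\ forall i, (i < k.+1)%N -> (m i <= n)%N.
have late_near k : \forall n \near \oo, late k n.
  have mk : \forall n \near \oo, forall i, (i < k.+1)%N -> (m i <= n)%N.
    by apply: near_lt => i _; exact: nbhs_infty_ge.
  by have kn := nbhs_infty_ge k; apply: filterS2 kn mk => n kn mn; split.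
exists [set x | exists2 j, E j x & late j x] => [t|j]; last first.
  by apply: filterS (late_near j) => x jx Ex; exists j.
apply: filterS (late_near t) => n lt_n.
have [||k /asboolP lk maxk] := @ex_maxnP (fun k => `[< late k n >]) n.
- by exists t; exact/asboolP.
- by move=> k /asboolP[].
have tk : (t <= k)%N by apply: maxk; exact/asboolP.
apply: leq_trans (hm k n _); last by apply: lk.2.
apply: leq_mul => //; apply: counting_le => x xn [[j Ejx lj] Cx].
split => //; exists j => //; apply: maxk; apply/asboolP; split.
  by apply: leq_trans lj.1 (ltnW xn).
by move=> i /lj.2 /leq_trans; apply; exact: ltnW.
Qed.

(** A sparse sequence [d] in [D] will do: the [i]-th term is so large that [C]
    has at least [i * (i + 1)] elements below it, so [range d] has about
    [sqrt c] elements below [n] when [C] has [c]. *)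
Lemma density_zero_tall D : unbounded D ->
  exists E, [/\ E `<=` D, Z E & unbounded E].
Proof.
move=> uD.
have /choice[d hd] i : exists d, [/\ D d, (i <= d)%N & (i * i.+1 <= cnt C d)%N].
  have [m _ hm] := counting_unbounded (i * i.+1)%N uC.
  have [d md Dd] := uD (maxn i m).
  exists d; split => //; first exact: leq_trans (leq_maxl _ _) md.
  by apply: hm; exact: leq_trans (leq_maxr _ _) md.
exists (range d); split => [_ [i _ <-]|t|m]; first by case: (hd i).
- apply: filterS (counting_unbounded (t * t)%N uC) => n tn.
  have [k /andP[kl kr]] : exists k, (k * k.+1 <= cnt C n < k.+1 * k.+2)%N.
    elim: (cnt C n) => [|c [k /andP[kl kr]]]; first by exists 0%N.
    have [ck|ck] := ltnP c.+1 (k.+1 * k.+2); first by exists k; lia.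
    by exists k.+1; nia.
  have : (cnt (range d `&` C) n <= k.+1)%N.
    apply: leq_trans (counting_image d k.+1 n).
    apply: counting_le => x xn [[i _ dix] _]; exists i => //=.
    have [_ _ hi] := hd i; rewrite dix in hi.
    by have := leq_trans hi (counting_homo C (ltnW xn)); nia.
  move=> ck; have [tk|kt] := leqP t k.
    exact: leq_trans (leq_mul tk ck) kl.
  exact: leq_trans (leq_mul (leqnn t) (leq_trans ck kt)) tn.
- by exists (d m); [by case: (hd m)|exists m].
Qed.

Lemma density_zero_tall_pideal : tall_pideal Z.
Proof.
split; [exact: density_zero_almostS|exact: density_zero_pseudounion|].
exact: density_zero_tall.
Qed.

Lemma density_zeroN : ~ Z C.
Proof.
move=> /(_ 2%N) h.
have [n []] := filter_ex (filterI h (counting_unbounded 1 uC)).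
by rewrite setIid; lia.
Qed.

End density.

(** * The group of sets topologized by tall P-ideals *)

(** A copy of [set nat], kept apart because its topology is not the one that a
    function space carries. *)
Definition ideal_space : Type := set nat.

HB.instance Definition _ := gen_eqMixin ideal_space.
HB.instance Definition _ := gen_choiceMixin ideal_space.

Definition ideal_coset (I : set (set nat)) (A : ideal_space) : set ideal_space :=
  [set B : ideal_space | I ((A : set nat) `+` B)].

Definition ideal_open (U : set ideal_space) :=
  forall A, U A -> exists2 I, tall_pideal I & ideal_coset I A `<=` U.

Lemma ideal_openT : ideal_open setT.
Proof. by move=> A _; exists setT => //; exact: tall_pideal_setT. Qed.

Lemma ideal_openI (U V : set ideal_space) :
  ideal_open U -> ideal_open V -> ideal_open (U `&` V).
Proof.
move=> oU oV A [/oU[I hI IU] /oV[J hJ JV]].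
exists (I `&` J); first exact: tall_pidealI.
by move=> B [/IU UB /JV VB].
Qed.

Lemma ideal_open_bigcup (K : Type) (U : K -> set ideal_space) :
  (forall k, ideal_open (U k)) -> ideal_open (\bigcup_k U k).
Proof.
move=> oU A [k _ /oU[I hI IU]].
by exists I => //; apply: subset_trans IU _ => B UB; exists k.
Qed.

HB.instance Definition _ := isOpenTopological.Build ideal_space
  ideal_openT ideal_openI ideal_open_bigcup.

Lemma ideal_space_openE (U : set ideal_space) : open U = ideal_open U.
Proof. by []. Qed.

Lemma ideal_coset_refl I A : tall_pideal I -> ideal_coset I A A.
Proof. by move=> hI; rewrite /ideal_coset /= setYK; exact: pideal_set0. Qed.

Lemma ideal_coset_open I A : tall_pideal I -> open (ideal_coset I A).
Proof.
move=> hI; rewrite ideal_space_openE => B AB; exists I => // C BC.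
exact: pideal_setY_trans AB BC.
Qed.

Lemma ideal_space_nbhsP (A : ideal_space) (P : set ideal_space) :
  nbhs A P <-> exists2 I, tall_pideal I & ideal_coset I A `<=` P.
Proof.
split; rewrite nbhsE.
  move=> [U [oU UA] UP]; have [I hI IU] := oU A UA.
  by exists I => //; exact: subset_trans UP.
move=> [I hI IP]; exists (ideal_coset I A) => //.
by split; [exact: ideal_coset_open|exact: ideal_coset_refl].
Qed.

(** Let [F n] in [I n] be a pseudo-union of the sets [A n `+` A m], [m >= n].
    Off [F n] all later [A m] agree with [A n] up to finitely many points, so the
    traces of the [A n] on the complements of the [F n] are coherent modulo
    finite sets and can be glued: [x] is put in [B] according to [A n] for the
    least [n] with [x] outside [F n]. *)
Lemma ideal_coset_fusion (I : nat -> set (set nat)) (A : nat -> ideal_space) :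
  (forall n, tall_pideal (I n)) ->
  (forall n m, (n <= m)%N -> ideal_coset (I n) (A n) (A m)) ->
  exists B, forall n, ideal_coset (I n) (A n) B.
Proof.
move=> hI AA.
have /choice[F hF] (n : nat) : exists F, I n F /\
    forall m, almost_subset ((A n : set nat) `+` A (n + m)%N) F.
  have [m|F IF hF] := pideal_pseudounion (hI n)
    (E := fun m => (A n : set nat) `+` A (n + m)%N).
    by apply: AA; exact: leq_addr.
  by exists F.
pose B : set nat :=
  [set x | exists n, [/\ A n x, ~ F n x & forall k, (k < n)%N -> F k x]].
exists B => n; apply: (pideal_almostS (hI n)) (hF n).1.
have := near_lt (fun k (_ : (k < n.+1)%N) => (hF k).2 (n - k)%N).
apply: filterS => x hx; apply: contraPP => nFx.
have [k kn [nFk Fk]] : exists2 k, (k <= n)%N &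
    ~ F k x /\ forall i, (i < k)%N -> F i x.
  have [k /asboolP Fk mink] := 
    @ex_minnP (fun k => `[< ~ F k x >]) (ex_intro _ n (asboolT nFx)).
  exists k; first by apply: mink; exact: asboolT.
  split => // i ik; apply: contrapT => /asboolT /mink.
  by rewrite leqNgt ik.
have AkE : A k x <-> A n x.
  have := hx k kn; rewrite subnKC// => AF.
  by split => Ax; apply: contrapT => nAx; apply: nFk; apply: AF; [left|right].
have BE : B x <-> A k x.
  split => [[j [Aj nFj Fj]]|Ak]; last by exists k; split.
  have [jk|kj|<-//] := ltngtP j k; first by have := Fk _ jk.
  by have := Fj _ kj.
by rewrite /setY /=; tauto.
Qed.

(** Alpha answers any open set by a coset inside it, looking only at the last
    move of beta. *)
Lemma ideal_space_alpha_favorable : alpha_favorable ideal_space.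
Proof.
pose answers W := [set V : set ideal_space | exists I A,
  [/\ tall_pideal I, V = ideal_coset I A & V `<=` W]].
have answersP W : nonempty_open W -> answers W (xget set0 (answers W)).
  move=> [oW [A WA]]; apply: xgetPex; have [I hI IW] := oW A WA.
  by exists (ideal_coset I A), I, A.
exists (fun l => xget set0 (answers (last setT l))) => U V.
have VE n : V n.+1 = xget set0 (answers (U n)).
  by rewrite /V /alpha_answers /mkseq -addn1 iotaD map_cat /= last_cat.
have VP n : beta_legal U V n -> answers (U n) (V n.+1).
  by move=> [Un _]; rewrite VE; exact: answersP.
split=> [n /(_ n (leqnn n))/VP[I [A [hI VIA IU]]]|legal].
  split=> //; rewrite VIA; split; first exact: ideal_coset_open.
  by exists A; exact: ideal_coset_refl.
have /choice[I /choice[A IA]] n := VP n (legal n).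
have Vdecr n m : (n <= m)%N -> V m.+1 `<=` V n.+1.
  move=> /subnKC <-; elim: (m - n)%N => [|k IH]; first by rewrite addn0.
  rewrite addnS; apply: subset_trans IH.
  by have [_ _ VU] := IA (n + k).+1; apply: subset_trans VU (proj2 (legal _) _).
have [n|n m nm|B hB] := @ideal_coset_fusion I A; first by case: (IA n).
  have [_ <- _] := IA n; apply: (Vdecr _ _ nm).
  by have [hI -> _] := IA m; exact: ideal_coset_refl.
exists B => -[//|n] _; have [_ -> _] := IA n; exact: hB.
Qed.

(** * Ultrafilters avoiding a tall P-ideal *)

Lemma ultrafilter_set1 (u : betaN) n :
  betaN_filter u [set n] -> u = betaN_of_nat n.
Proof.
move=> un; apply: betaN_eq; apply/esym/max_filter => A uA.
apply/principal_filterP.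
have : betaN_filter u (A `&` [set n]) by exact: filterI.
by move=> /filter_ex[m [Am /= <-]].
Qed.

Lemma ultrafilter_setC (u : betaN) A :
  betaN_filter u (~` A) <-> ~ betaN_filter u A.
Proof.
rewrite -[betaN_filter u (~` A)]/(betaN_base (~` A) u) -betaN_baseC.
by [].
Qed.

Lemma betaN_remainder_unbounded (u : betaN) C :
  betaN_remainder u -> betaN_filter u C -> unbounded C.
Proof.
move=> ru uC m.
have : betaN_filter u (~` `I_m).
  elim: m => [|m IH]; first by rewrite II0 setC0; exact: filterT.
  rewrite IIS setCU; apply: filterI => //.
  have [/ultrafilter_set1 um|//] := in_ultra_setVsetC [set m] (betaN_ultra u).
  by exfalso; apply: ru; exists m.
move=> /(filterI uC)/filter_ex[n [Cn /= nm]]; exists n => //.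
by rewrite leqNgt; apply/negP.
Qed.

Definition avoids (I : set (set nat)) (u : betaN) :=
  forall E, I E -> ~ betaN_filter u E.

Lemma avoids_remainder I u : tall_pideal I -> avoids I u -> betaN_remainder u.
Proof.
move=> hI uI [n _ nu]; apply: (uI [set n]).
  by apply: (pideal_bounded hI (m := n.+1)) => _ -> /=.
by rewrite -nu; exact/principal_filterP.
Qed.

Definition tall_remainder : set betaN_remainder :=
  [set u | exists2 I, tall_pideal I & avoids I (set_val u)].

(** The sets containing almost all of [C] modulo [I] form a proper filter. *)
Lemma avoiding_ultrafilter I C : tall_pideal I -> ~ I C ->
  exists2 u, avoids I u & betaN_filter u C.
Proof.
move=> hI nIC; pose F : set_system nat := [set S | I (C `\` S)].
have FF : ProperFilter F.
  split; first by rewrite /F /= setD0.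
  split=> [|P Q FP FQ|P Q PQ]; rewrite /F /=.
  - by rewrite setDT; exact: pideal_set0.
  - by rewrite setDIr; exact: pideal_setU.
  - by apply: (pideal_sub hI) => x [Cx nQ]; split => // /PQ.
have [G [uG FG]] := ultraFilterLemma FF.
exists (BetaN uG) => [E IE /= GE|/=]; last first.
  by apply: FG; rewrite /F /= setDv; exact: pideal_set0.
have GC : G (~` E).
  by apply: FG; apply: (pideal_sub hI) IE => x [_ /= /contrapT].
have : G (E `&` ~` E) by exact: filterI.
by rewrite setICr => /filter_not_empty.
Qed.

(** Open sets of a subspace of the remainder, expressed through the base of the
    compactification rather than through two nested inclusions. *)
Section subspaces.
Variable Y : set betaN_remainder.

Definition ultra (y : Y) : set_system nat := betaN_filter (set_val (set_val y)).

#[global] Instance ultra_ultrafilter (y : Y) : UltraFilter (ultra y).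
Proof. exact: betaN_ultra. Qed.

Lemma subspace_base_open A : open [set y : Y | ultra y A].
Proof.
have -> : [set y : Y | ultra y A] =
    (set_val \o set_val) @^-1` (betaN_base A) by [].
apply: open_comp (betaN_base_open A) => y _.
by apply: continuous_comp; exact: initial_continuous.
Qed.

Lemma remainder_openP (U : set betaN_remainder) u : open U -> U u ->
  exists2 A, betaN_filter (set_val u) A &
    forall v : betaN_remainder, betaN_filter (set_val v) A -> U v.
Proof.
move=> [V oV <-] Vu; have [A uA AV] := (betaN_openE V).1 oV _ Vu.
by exists A => // v vA; exact: AV.
Qed.

Lemma subspace_openP (U : set Y) y : open U -> U y ->
  exists2 A, ultra y A & forall z, ultra z A -> U z.
Proof.
move=> [V oV <-] Vy; have [A yA AV] := remainder_openP oV Vy.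
by exists A => // z zA; exact: AV.
Qed.

End subspaces.

Lemma tall_remainder_base C : unbounded C ->
  exists y : tall_remainder, ultra y C.
Proof.
move=> uC; have hZ := density_zero_tall_pideal uC.
have [v vZ vC] := avoiding_ultrafilter hZ (density_zeroN uC).
have Yv : tall_remainder (SigSub (mem_set (avoids_remainder hZ vZ))).
  by exists (relative_density_zero C).
by exists (SigSub (mem_set Yv)).
Qed.

Lemma tall_remainder_dense : dense tall_remainder.
Proof.
move=> W [u Wu] oW; have [C uC CW] := remainder_openP oW Wu.
have [y yC] := tall_remainder_base (betaN_remainder_unbounded (set_valP u) uC).
by exists (set_val y); split; [exact: CW|exact: set_valP].
Qed.

(** Were there no finite subcover, some [y n] would miss [U k] for all [k < n].
    A cluster point of the [y n] in the compactification avoids the intersection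
    of the ideals that the [y n] avoid, so it lies in [Y] and in some [U k]; then
    [U k] contains [y n] for arbitrarily large [n]. *)
Lemma tall_remainder_countably_compact :
  countably_compact [set: tall_remainder].
Proof.
move=> U oU cU; apply: contrapT => noU.
have /choice[y hy] (n : nat) :
    exists y : tall_remainder, forall k, (k < n)%N -> ~ U k y.
  apply: contrapT => noy; apply: noU.
  exists [fset k in iota 0 n]%fset => [k _|z _]; first exact: mem_set.
  apply: contrapT => nz; apply: noy; exists z => k kn Uz; apply: nz.
  by exists k => //=; rewrite !inE /= mem_iota.
have /choice[I hI] (n : nat) :
    exists I, tall_pideal I /\ avoids I (set_val (set_val (y n))).
  by have [I ? ?] := set_valP (y n); exists I.
pose J : set (set nat) := [set E | forall n, I n E].
have hJ : tall_pideal J by apply: tall_pideal_bigcap => n; exact: (hI n).1.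
pose v n : betaN := set_val (set_val (y n)).
have [u [_ cu]] :=
  betaN_compact (fmap_proper_filter v eventually_filter) filterT.
have uP A k : betaN_filter u A -> exists2 n, (k < n)%N & betaN_filter (v n) A.
  move=> uA; have : v @` [set n | (k < n)%N] `&` betaN_base A !=set0.
    apply: cu; last first.
      by apply: open_nbhs_nbhs; split; first exact: betaN_base_open.
    by apply: filterS (nbhs_infty_gt k) => n kn; exists n.
  by move=> [_ [[n kn <-] vA]]; exists n.
have uJ : avoids J u.
  by move=> E JE /(uP _ 0%N)[n _]; exact: (hI n).2 (JE n).
have Yu : tall_remainder (SigSub (mem_set (avoids_remainder hJ uJ))).
  by exists J.
have [k _ Uk] := cU (SigSub (mem_set Yu)) Logic.I.
have [A uA AU] := subspace_openP (oU k) Uk.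
have [n kn vA] := uP A k uA.
exact: hy kn (AU _ vA).
Qed.

(** * The membership function *)

Section evaluation.
Variable R : realType.

Definition evaluation (p : ideal_space * tall_remainder) : R :=
  (`[< ultra p.2 p.1 >])%:R.

Lemma locally_constant_continuous (T S : topologicalType) (g : T -> S) :
  (forall x, \forall z \near x, g z = g x) -> continuous g.
Proof.
move=> gc x W /nbhs_singleton Wx.
by apply: filterS (gc x) => z gzx; rewrite /= gzx.
Qed.

Lemma evaluation_separately_continuous : separately_continuous evaluation.
Proof.
split=> [A|y]; apply: locally_constant_continuous; last move=> A.
  move=> y; have near_ultra B : ultra y B -> \forall z \near y, ultra z B.
    by move=> yB; apply: open_nbhs_nbhs; split => //; exact: subspace_base_open.
  have [yA|yA] := pselect (ultra y A).
    apply: filterS (near_ultra A yA) => z zA.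
    by rewrite /evaluation !asboolT.
  apply: filterS (near_ultra (~` A) _) => [z|]; last exact/ultrafilter_setC.
  by move=> /ultrafilter_setC zA; rewrite /evaluation !asboolF.
have [I hI yI] := set_valP y.
apply/ideal_space_nbhsP; exists I => // B AB.
rewrite /= /evaluation; congr ((nat_of_bool _)%:R)%R.
apply: asbool_equiv_eq => /=.
have yAB : ultra y (~` ((A : set nat) `+` B)) by apply/ultrafilter_setC/yI.
by split=> yA; apply: filterS2 yAB yA => x xAB Ax; apply: contrapT => nBx;
  by apply: xAB; by [left|right].
Qed.

Lemma evaluation_discontinuous p : ~ {for p, continuous evaluation}.
Proof.
case: p => A y fc.
have : nbhs (A, y) [set q | evaluation q = evaluation (A, y)].
  have /cvgr_dist_lt/(_ _ ltr01) := fc; apply: filterS => q /=.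
  rewrite /evaluation /=.
  by do 2 case: asboolP => _ //=; rewrite ?subr0 ?sub0r ?normrN normr1 ltxx.
case=> -[P Q] /= [nP nQ] PQ.
have [I hI IP] := (ideal_space_nbhsP _ _).1 nP.
move: nQ; rewrite nbhsE => -[W [oW Wy] WQ].
have [C yC CO] := subspace_openP oW Wy.
have unbC : unbounded C.
  exact: betaN_remainder_unbounded (set_valP (set_val y)) yC.
have [D [DC ID unbD]] := pideal_tall hI unbC.
have [z zD] := tall_remainder_base unbD.
have Qz : Q z by apply/WQ/CO; exact: filterS DC zD.
(* Adding [D] to [A] or removing it stays in the coset of [A] modulo [I], yet
   decides membership in [z] in opposite ways. *)
have eD : evaluation ((A : set nat) `|` D, z) = evaluation (A, y).
  apply: PQ; split => //=; apply: IP.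
  by apply: (pideal_sub hI) ID => x /=; tauto.
have eN : evaluation ((A : set nat) `\` D, z) = evaluation (A, y).
  apply: PQ; split => //=; apply: IP.
  by apply: (pideal_sub hI) ID => x /=; have [] := pselect (D x); tauto.
move: eD; rewrite -eN /evaluation /= asboolT; last first.
  by apply: filterS zD; exact: subsetUr.
rewrite asboolF; first by move=> /eqP; rewrite oner_eq0.
suff : ultra z (~` ((A : set nat) `\` D)) by move/ultrafilter_setC.
by apply: filterS zD => x Dx [].
Qed.

End evaluation.

Theorem mainTheorem2 (R : realType) :
  exists (X : topologicalType) (Y : set betaN_remainder)
    (f : X * Y -> R),
    [/\ [set: X] !=set0,
        alpha_favorable X,
        countably_compact [set: Y],
        dense Y &
        separately_continuous f /\ forall p, ~ {for p, continuous f}].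
Proof.
exists ideal_space, tall_remainder, (evaluation R); split.
- by exists (set0 : set nat).
- exact: ideal_space_alpha_favorable.
- exact: tall_remainder_countably_compact.
- exact: tall_remainder_dense.
- split; first exact: evaluation_separately_continuous.
  exact: evaluation_discontinuous.
Qed.
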